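(* Let $T_2,T_3\in \mathcal{L}_A(\mathcal{H})$. Then $$w_{\mathbb{A}}^2\left(\begin{bmatrix} 0 & T_2\\ T_3 & 0\end{bmatrix}\right)\geq \frac{1}{2}\max\left\{w_A(T_2 T_3+T_3 T_2),\ w_A(T_2 T_3-T_3 T_2)\right\},$$ where $w_{\mathbb{A}}^2(\cdot)=(w_{\mathbb{A}}(\cdot))^2$.
   Context: $\mathcal{H}$ is a complex Hilbert space with inner product $\langle\cdot,\cdot\rangle$, and $\mathcal{L}(\mathcal{H})$ is the algebra of bounded linear operators on $\mathcal{H}$. $A\in\mathcal{L}(\mathcal{H})$ is a fixed positive operator, i.e. $A=A^*$ and $\langle Ax,x\rangle\ge 0$ for all $x\in\mathcal{H}$ ($A$ need not be injective). Put $\langle x,y\rangle_A=\langle Ax,y\rangle$ and $\|x\|_A=\sqrt{\langle x,x\rangle_A}$ (a seminorm). $\mathcal{R}(\cdot)$ denotes the range, and $\mathcal{L}_A(\mathcal{H})=\{T\in\mathcal{L}(\mathcal{H}):\mathcal{R}(T^*A)\subseteq\mathcal{R}(A)\}$ (the operators admitting an $A$-adjoint, i.e. an $X\in\mathcal{L}(\mathcal{H})$ with $AX=T^*A$); it is a subalgebra of $\mathcal{L}(\mathcal{H})$. For $T\in\mathcal{L}_A(\mathcal{H})$ the $A$-numerical radius is $w_A(T)=\sup\{|\langle Tx,x\rangle_A| : x\in\mathcal{H},\ \|x\|_A=1\}$. $\mathbb{A}=\begin{bmatrix} A&0\\0&A\end{bmatrix}$ is the positive diagonal operator on $\mathcal{H}\oplus\mathcal{H}$,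 and $w_{\mathbb{A}}$ is the numerical radius defined in the same way with $(\mathcal{H}\oplus\mathcal{H},\mathbb{A})$ in place of $(\mathcal{H},A)$. *)

(* Defs.v *)
From HB Require Import structures.
From mathcomp Require Import all_boot all_order all_algebra.
From mathcomp Require Import sesquilinear.
From mathcomp Require Import complex.
From mathcomp Require Import all_classical all_reals all_analysis.

Set Implicit Arguments.
Unset Strict Implicit.
Unset Printing Implicit Defensive.

Import Order.TTheory GRing.Theory Num.Theory.
Import numFieldNormedType.Exports.

Local Open Scope classical_set_scope.
Local Open Scope complex_scope.
Local Open Scope ring_scope.

(* Positive definite sesquilinear forms, linear in the first argument and
   conjugate-linear in the second one. *)
Notation "{ 'inner' V }" := {dot V for Num.conj} (format "{ 'inner'  V }").

Section DirectSum.
Context {R : realType} {V : lmodType R[i]}.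

Definition dsum_dot (dot : {inner V}) (u v : V * V) : R[i] :=
  dot u.1 v.1 + dot u.2 v.2.

Variable dot : {inner V}.

Let dsum_dot_bilinear : bilinear_for
  ( *%R : GRing.Scale.law R[i] R[i]) (Num.conj \; *%R : GRing.Scale.law R[i] R[i])
  (dsum_dot dot).
Proof.
split=> [v a x y|u a x y]; rewrite /dsum_dot /=.
  by rewrite !linearPl /= mulrDr addrACA.
by rewrite !linearPr /= mulrDr addrACA.
Qed.

HB.instance Definition _ := bilinear_isBilinear.Build R[i] (V * V)%type
  (V * V)%type R[i] _ _ (dsum_dot dot) dsum_dot_bilinear.

Let dsum_dot_hermitian u v :
  dsum_dot dot u v = (-1) ^+ false * Num.conj (dsum_dot dot v u).
Proof.
rewrite /dsum_dot [dot u.1 _]hermitian_subproof [dot u.2 _]hermitian_subproof.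
by rewrite expr0 !mul1r rmorphD.
Qed.

HB.instance Definition _ := isHermitianSesquilinear.Build R[i] (V * V)%type
  false Num.conj (dsum_dot dot) dsum_dot_hermitian.

Let dsum_dot_gt0 u : u != 0 -> 0 < dsum_dot dot u u.
Proof.
have dot_ge0 x : 0 <= dot x x.
  have [->|x0] := eqVneq x 0; first by rewrite linear0l.
  exact/ltW/neq0_dnorm_gt0.
case: u => x y; rewrite /dsum_dot /=.
have [->|x0 _] := eqVneq x 0; last exact: ltr_pwDl (neq0_dnorm_gt0 _ x0) _.
have [->|y0 _] := eqVneq y 0; first by rewrite eqxx.
exact: ltr_wpDl (neq0_dnorm_gt0 _ y0).
Qed.

HB.instance Definition _ := isDotProduct.Build R[i] (V * V)%type
  (dsum_dot dot) dsum_dot_gt0.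

End DirectSum.

Definition block_op {R : realType} {V : lmodType R[i]}
    (T11 T12 T21 T22 : V -> V) (u : V * V) : V * V :=
  (T11 u.1 + T12 u.2, T21 u.1 + T22 u.2).

Section NumericalRadius.
Context {R : realType} {V : lmodType R[i]}.
Variables (dot : {inner V}) (A : V -> V).

Definition dotA (x y : V) : R[i] := dot (A x) y.

Definition normA (x : V) : R := Num.sqrt (complex.Re (dotA x x)).

(* A supremum in R.  When A is positive, the set below is empty only for A = 0,
   in which case sup is 0.  When T admits an A-adjoint, T is bounded for the
   A-seminorm, so the set has an upper bound and sup is the true supremum. *)
Definition wA (T : V -> V) : R :=
  sup [set ComplexField.Normc.normc (dotA (T x) x) | x in [set x | normA x = 1]].

End NumericalRadius.

Section Operators.
Context {R : realType} {H : completeNormedModType R[i]}.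

(* With this condition, (H, dot) is a complex Hilbert space. *)
Definition norm_induced_by (dot : {inner H}) : Prop :=
  forall x : H, `|x| ^+ 2 = dot x x.

Definition bounded_op (T : {linear H -> H}) : Prop :=
  bounded_near T (nbhs (0 : H)).

Definition is_adjoint (dot : {inner H}) (T S : {linear H -> H}) : Prop :=
  forall x y : H, dot (T x) y = dot x (S y).

Definition positive_op (dot : {inner H}) (A : {linear H -> H}) : Prop :=
  [/\ bounded_op A, is_adjoint dot A A & forall x : H, 0 <= dot (A x) x].

(* The algebra L_A(H).  On a Hilbert space the Riesz theorem provides every
   bounded operator T with exactly one bounded adjoint, so Ts below is T^*. *)
Definition in_LA (dot : {inner H}) (A T : {linear H -> H}) : Prop :=
  bounded_op T /\
  exists Ts : {linear H -> H},
    [/\ bounded_op Ts, is_adjoint dot T Ts & range (Ts \o A) `<=` range A].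

End Operators.

(* Main.v *)
(* Write |x| for the A-seminorm, w for the numerical radius of the block operator
   and s = |T3 x|, where |x| = 1.  Testing w on the vector (x, c T3 x / s) / sqrt 2,
   with a phase c that aligns the two terms of the quadratic form, gives
   |<T2 T3 x, x>_A| + s^2 <= 2 w s, hence |<T2 T3 x, x>_A| <= w^2.  Exchanging the
   roles of T2 and T3 gives the same bound for T3 T2, and the triangle inequality
   concludes.

   This needs w to be a true supremum, so the T_i have to be bounded for |.|.  For
   T in L_A(H), the vectors A T x with ||A x|| <= 1 form a weakly bounded set: for
   T^* A z = A z' one has <A T x, z> = <A x, z'>.  By uniform boundedness
   ||A T x|| <= C ||A x||.  A Krein-Lax iteration then turns this bound for
   ||A .|| into one for the A-seminorm. *)

Require Import Defs.
From HB Require Import structures.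
From mathcomp Require Import all_boot all_order all_algebra.
From mathcomp Require Import sesquilinear.
From mathcomp Require Import complex.
From mathcomp Require Import all_classical all_reals all_analysis.
From mathcomp Require Import ring lra.

Import Order.TTheory GRing.Theory Num.Theory.
Import numFieldNormedType.Exports.
Local Open Scope complex_scope.
Local Open Scope ring_scope.

Local Notation normc := ComplexField.Normc.normc.

(** * The modulus of a complex number as a real number *)

Section ComplexNorm.
Context {R : realType}.
Implicit Types (z : R[i]) (c : R).

Lemma normc_ge0 z : 0 <= normc z.
Proof. by rewrite -ler0c; exact: (normr_ge0 z). Qed.

Lemma normcD z1 z2 : normc (z1 + z2) <= normc z1 + normc z2.
Proof. by rewrite -lecR rmorphD; exact: (ler_normD z1 z2). Qed.

Lemma normcB z1 z2 : normc (z1 - z2) <= normc z1 + normc z2.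
Proof. by rewrite -lecR rmorphD; exact: (ler_normB z1 z2). Qed.

Lemma normcM z1 z2 : normc (z1 * z2) = normc z1 * normc z2.
Proof. exact: ComplexField.Normc.normcM. Qed.

Lemma normc_conj z : normc (Num.conj z) = normc z.
Proof. by apply: (@complexI R); exact: (norm_conjC z). Qed.

Lemma normc_nng c : 0 <= c -> normc c%:C = c.
Proof. by move=> c0; rewrite /= expr0n/= addr0 sqrtr_sqr ger0_norm. Qed.

Lemma conj_real c : Num.conj c%:C = c%:C.
Proof. by apply/conj_Creal/complex_realP; exists c. Qed.

End ComplexNorm.

Lemma dotC {R : realType} {V : lmodType R[i]} (dot : {inner V}) (x y : V) :
  dot x y = Num.conj (dot y x).
Proof. by rewrite [LHS]hermC expr0 mul1r. Qed.

(** * The semi-inner product of a positive operator *)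

Section PositiveForm.
Context {R : realType} {V : lmodType R[i]}.
Variables (dot : {inner V}) (A : {linear V -> V}).
Hypothesis A_sym : forall x y, dot (A x) y = dot x (A y).
Hypothesis A_ge0 : forall x, 0 <= dot (A x) x.

Lemma dotAC x y : dotA dot A y x = Num.conj (dotA dot A x y).
Proof. by rewrite /dotA A_sym dotC. Qed.

Lemma dotAxx x : dotA dot A x x = (normA dot A x ^+ 2)%:C.
Proof.
have q_real : (complex.Re (dotA dot A x x))%:C = dotA dot A x x.
  exact/RRe_real/ger0_real/A_ge0.
by rewrite /normA sqr_sqrtr ?q_real// -ler0c q_real A_ge0.
Qed.

Lemma normA_ge0 x : 0 <= normA dot A x.
Proof. exact: sqrtr_ge0. Qed.

Lemma dotAZl a x y : dotA dot A (a *: x) y = a * dotA dot A x y.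
Proof. by rewrite /dotA linearZ linearZl_LR. Qed.

Lemma dotAZr a x y : dotA dot A x (a *: y) = Num.conj a * dotA dot A x y.
Proof. by rewrite /dotA linearZr_LR. Qed.

Lemma normAZ a x : normA dot A (a *: x) = normc a * normA dot A x.
Proof.
apply/eqP; rewrite -(@eqrXn2 _ 2) ?mulr_ge0 ?normA_ge0 ?sqrtr_ge0//; last first.
  by case: (a) => *; rewrite /= sqrtr_ge0.
rewrite -(inj_eq (@complexI _)) -dotAxx dotAZl dotAZr mulrA dotAxx.
by rewrite -normCK (_ : `|a| = (normc a)%:C)// -rmorphXn -rmorphM exprMn.
Qed.

(** The form is nonnegative at [x - s b y] for every real [s]; the factor [b] makes the cross terms
    real. Since the form may be degenerate, a null [y] is treated separately. *)
Lemma CauchySchwarzA x y :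
  normc (dotA dot A x y) <= normA dot A x * normA dot A y.
Proof.
set b := dotA dot A x y.
have quad s : 0 <= normA dot A x ^+ 2 - 2 * s * normc b ^+ 2
    + s ^+ 2 * normc b ^+ 2 * normA dot A y ^+ 2.
  rewrite -ler0c.
  suff -> : (normA dot A x ^+ 2 - 2 * s * normc b ^+ 2
    + s ^+ 2 * normc b ^+ 2 * normA dot A y ^+ 2)%:C =
    dotA dot A (x - (s%:C * b) *: y) (x - (s%:C * b) *: y) by exact: A_ge0.
  have b2 : (normc b)%:C ^+ 2 = b * Num.conj b by rewrite -normCK.
  have x2 z : (normA dot A z)%:C ^+ 2 = dotA dot A z z by rewrite dotAxx rmorphXn.
  rewrite !(rmorphXn, rmorphD, rmorphN, rmorphM)/= !b2 !x2.
  have -> z : dotA dot A (x - z) (x - z) =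
      dotA dot A x x - dotA dot A x z - (dotA dot A z x - dotA dot A z z).
    by rewrite /dotA (raddfB A) linearBl !linearBr.
  rewrite dotAZr dotAZl dotAZl dotAZr (dotAC x y) -/b.
  have -> : Num.conj (s%:C * b) = s%:C * Num.conj b.
    by rewrite rmorphM; congr (_ * _); exact: conj_real.
  rewrite (_ : 1%:C = 1)//; ring.
rewrite -(@ler_pXn2r _ 2) ?nnegrE ?mulr_ge0 ?normA_ge0 ?normc_ge0// exprMn.
have [->|b_neq0] := eqVneq (normc b) 0; first by rewrite expr0n mulr_ge0 ?sqr_ge0.
have [y0|y_neq0] := eqVneq (normA dot A y) 0.
  (* For null [y] the expression is affine in [s]; this [s] gives it the negative value
     [- normA dot A x ^+ 2 - 2]. *)
  have := quad ((normA dot A x ^+ 2 + 1) / normc b ^+ 2).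
  rewrite y0 expr0n mulr0 addr0 -mulrA divfK ?expf_neq0//.
  have := sqr_ge0 (normA dot A x); lra.
have n2_gt0 : 0 < normA dot A y ^+ 2 by rewrite exprn_even_gt0.
(* This [s] minimises the quadratic. *)
have := quad (normA dot A y ^+ 2)^-1.
set n2 := normA dot A y ^+ 2 in n2_gt0 *.
set m2 := normA dot A x ^+ 2; set c2 := normc b ^+ 2.
have -> : m2 - 2 * n2^-1 * c2 + n2^-1 ^+ 2 * c2 * n2 = (m2 * n2 - c2) / n2.
  by field; rewrite gt_eqF.
by rewrite pmulr_lge0 ?invr_gt0// subr_ge0.
Qed.

End PositiveForm.

Lemma expr_inv3_small {R : realType} (e : R) : 0 < e ->
  exists n, 3^-1 ^+ n < e.
Proof.
move=> e0; exists (Num.truncn e^-1).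
rewrite exprVn -[ltRHS]invrK ltf_pV2 ?posrE ?exprn_gt0 ?invr_gt0//.
apply: lt_le_trans (truncnS_gt _) _.
by rewrite -natrX ler_nat ltn_expl.
Qed.

Lemma ler_1DMn_expr {R : realDomainType} {h : R} n : 0 <= h ->
  1 + n%:R * h <= (1 + h) ^+ n.
Proof.
move=> h0; elim: n => [|n IHn]; first by rewrite mul0r addr0 expr0.
rewrite exprS -natr1; have := mulr_ge0 h0 h0; have := ler0n R n; nra.
Qed.

(** * The norm with real values, and geometric Cauchy sequences *)

Section RealNorm.
Context {R : realType} {H : completeNormedModType R[i]}.

Definition rnorm (x : H) : R := complex.Re `|x|.

Lemma rnormE x : `|x| = (rnorm x)%:C.
Proof. by rewrite /rnorm RRe_real ?normr_real. Qed.

Lemma rnorm_ge0 x : 0 <= rnorm x.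
Proof. by rewrite -ler0c -rnormE. Qed.

Lemma rnormD x y : rnorm (x + y) <= rnorm x + rnorm y.
Proof. by rewrite -lecR rmorphD/= -!rnormE ler_normD. Qed.

Lemma rnormZ a x : rnorm (a *: x) = normc a * rnorm x.
Proof. by apply: (@complexI R); rewrite rmorphM/= -!rnormE normrZ. Qed.

Lemma rnormN x : rnorm (- x) = rnorm x.
Proof. by rewrite /rnorm normrN. Qed.

Lemma rnorm0_eq0 x : rnorm x = 0 -> x = 0.
Proof. by move=> x0; apply/normr0_eq0; rewrite rnormE x0. Qed.

(** The steps after [n] add up to at most half of [3^-1 ^+ n]. The factor 3/4 leaves slack for the
    passage to the limit and stays below 1, as the gliding hump requires. *)
Lemma cvg_third_steps (x : nat -> H) :
  (forall n, rnorm (x n.+1 - x n) <= 3^-1 ^+ n.+1) ->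
  exists l, forall n, rnorm (l - x n) <= 3 / 4 * 3^-1 ^+ n.
Proof.
move=> step.
(* The right-hand side is the exact geometric sum, so the induction closes. *)
have tail n k : rnorm (x (n + k)%N - x n) <= 2^-1 * (3^-1 ^+ n - 3^-1 ^+ (n + k)).
  elim: k => [|k IHk].
    by rewrite addn0 !subrr /rnorm normr0 mulr0.
  rewrite addnS -(subrKA (x (n + k)%N)).
  apply: le_trans (rnormD _ _) _; have := step (n + k)%N.
  rewrite exprS; lra.
have pow_gt0 n : 0 < 3^-1 ^+ n :> R by rewrite exprn_gt0.
have tail' n k : rnorm (x (n + k)%N - x n) < 3^-1 ^+ n.
  apply: le_lt_trans (tail n k) _; have := pow_gt0 n; have := pow_gt0 (n + k)%N.
  lra.
have /cvg_ex[l xl] : cvg (x @ \oo)%classic.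
  apply: cauchy_cvg; apply: cauchy_exP => e e0.
  have eE : (complex.Re e)%:C = e by rewrite RRe_real ?gtr0_real.
  have [|n n_lt] := expr_inv3_small (complex.Re e).
    by rewrite -ltcR eE.
  exists (x n), n => // m /= nm; rewrite -ball_normE /= distrC rnormE -eE ltcR.
  by apply: lt_trans n_lt; rewrite -(subnKC nm).
exists l => n.
have e_gt0 : (0 : R[i]) < (4^-1 * 3^-1 ^+ n)%:C by rewrite -[0]/(0%:C) ltcR mulr_gt0.
move: (xl) => /cvgr_dist_lt /(_ _ e_gt0) [N _ /(_ (n + N)%N (leq_addl _ _))] /=.
rewrite rnormE ltcR => lN.
rewrite -(subrKA (x (n + N)%N)); apply: le_trans (rnormD _ _) _.
have := tail n N; have := pow_gt0 (n + N)%N; lra.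
Qed.

Lemma bounded_op_rnorm (T : {linear H -> H}) : bounded_op T ->
  exists2 M : R, 0 < M & forall x, rnorm (T x) <= M * rnorm x.
Proof.
move/linear_boundedP => [M [M_real /(_ (`|M| + 1))]].
have M1 : M < `|M| + 1 by rewrite (le_lt_trans (real_ler_norm _))// ltrDl.
move=> /(_ M1) bT; exists (normc M + 1).
  by rewrite ltr_wpDl// normc_ge0.
by move=> x; rewrite -lecR rmorphM rmorphD/= -!rnormE; exact: bT.
Qed.

End RealNorm.

(** * Uniform boundedness in a Hilbert space *)

Section HilbertSpace.
Context {R : realType} {H : completeNormedModType R[i]}.
Variables (dot : {inner H}).
Hypothesis Hdot : norm_induced_by dot.

Lemma dotxx x : dot x x = (rnorm x ^+ 2)%:C.
Proof. by rewrite -Hdot rnormE rmorphXn. Qed.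

Lemma CauchySchwarz_rnorm x y : normc (dot x y) <= rnorm x * rnorm y.
Proof.
have normE z : normA dot idfun z = rnorm z.
  by rewrite /normA /dotA /= dotxx /= sqrtr_sqr ger0_norm ?rnorm_ge0.
rewrite -!normE.
by apply: (@CauchySchwarzA R H dot idfun) => //= z; rewrite dnorm_ge0.
Qed.

(* Gliding hump (Sokal): moving by [+- 3 ^- n] along [g] gains [3 ^- n * rnorm g]
   in one of the two directions, and all later moves lose at most 3/4 of it. *)
Lemma uniform_boundedness (S : set H) :
  (forall z, exists K : R, forall g, S g -> normc (dot g z) <= K) ->
  exists C : R, forall g, S g -> rnorm g <= C.
Proof.
move=> S_weak; apply: contrapT => S_unbounded.
have large (C : R) : exists2 g, S g & C < rnorm g.
  apply: contrapT => C_bound; apply: S_unbounded; exists C => g Sg.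
  by rewrite leNgt; apply/negP => gC; apply: C_bound; exists g.
have t_gt0 n : 0 < 3^-1 ^+ n :> R by rewrite exprn_gt0.
(* The state carries the step number, which fixes the length of the move. Norms above [4 ^+ n]
   outgrow the shrinking moves [3^-1 ^+ n], so the gains tend to infinity. *)
have /choice[next nextP] (p : nat * H) : exists x' : H,
    rnorm (x' - p.2) <= 3^-1 ^+ p.1.+1 /\
    exists g, [/\ S g, 4 ^+ p.1.+1 < rnorm g &
                  3^-1 ^+ p.1.+1 * rnorm g <= normc (dot g x')].
  case: p => n x /=.
  have [g Sg g_large] := large (4 ^+ n.+1).
  have g_gt0 : 0 < rnorm g by apply: le_lt_trans g_large; rewrite exprn_ge0.
  pose c : R := 3^-1 ^+ n.+1 / rnorm g.
  have c_ge0 : 0 <= c by rewrite divr_ge0// ltW.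
  have normc_c : normc c%:C = c by exact: normc_nng.
  pose xi := c%:C *: g.
  have xi_norm : rnorm xi = 3^-1 ^+ n.+1.
    by rewrite rnormZ normc_c divfK// gt_eqF.
  have dot_xi : normc (dot g xi) = 3^-1 ^+ n.+1 * rnorm g.
    have -> : dot g xi = Num.conj c%:C * dot g g by rewrite linearZr_LR.
    rewrite normcM normc_conj normc_c dotxx normc_nng ?sqr_ge0//.
    by rewrite expr2 mulrA divfK// gt_eqF.
  (* By this identity, one of [x + xi] and [x - xi] pairs with [g] to at least the modulus of
     [dot g xi]. *)
  have split_xi : 2 * dot g xi = dot g (x + xi) - dot g (x - xi).
    by rewrite linearDr linearBr /=; ring.
  have two : 2 * normc (dot g xi) <=
      normc (dot g (x + xi)) + normc (dot g (x - xi)).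
    rewrite (le_trans _ (normcB _ _))// -split_xi normcM.
    by rewrite -[2]/(2%:R) -(rmorph_nat (real_complex R)) normc_nng.
  have [big|small] := leP (3^-1 ^+ n.+1 * rnorm g) (normc (dot g (x + xi))).
    by exists (x + xi); rewrite addrC addKr xi_norm; split=> //; exists g.
  exists (x - xi); split; first by rewrite addrC addKr rnormN xi_norm.
  by exists g; split=> //; move: two; rewrite dot_xi; lra.
pose x := fix x n := if n is m.+1 then next (m, x m) else 0.
have [l lP] : exists l, forall n, rnorm (l - x n) <= 3 / 4 * 3^-1 ^+ n.
  by apply: cvg_third_steps => n; have [] := nextP (n, x n).
have [K KP] := S_weak l.
(* The gain [P] at this step satisfies [P <= K + 3/4 P], so [P <= 4 K], while Bernoulli for
   [(4/3) ^+ n.+1] gives [P >= 1 + n.+1 / 3]. Hence [n < 12 K]. *)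
have [n nK] : exists n, 12 * K < n%:R.
  by exists (Num.truncn (12 * K)).+1; exact: truncnS_gt.
have [_ [g [Sg g_large g_x]]] := nextP (n, x n).
have dot_err : normc (dot g (x n.+1 - l)) <= rnorm g * (3 / 4 * 3^-1 ^+ n.+1).
  rewrite (le_trans (CauchySchwarz_rnorm _ _))// ler_wpM2l ?rnorm_ge0//.
  by rewrite -rnormN opprB; exact: (lP n.+1).
have dot_x : normc (dot g (x n.+1)) <= K + normc (dot g (x n.+1 - l)).
  have -> : dot g (x n.+1) = dot g l + dot g (x n.+1 - l).
    by rewrite linearBr /= addrC subrK.
  by rewrite (le_trans (normcD _ _))// lerD2r KP.
have growth : 1 + n.+1%:R * 3^-1 <= 3^-1 ^+ n.+1 * rnorm g.
  have h3 : 0 <= 3^-1 :> R by [].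
  apply: le_trans (ler_1DMn_expr n.+1 h3) _.
  rewrite (_ : 1 + 3^-1 = 3^-1 * 4 :> R); last by field.
  by rewrite exprMn ler_wpM2l ?ltW.
move: growth; rewrite -(natr1 n) => growth.
by move: g_x dot_x dot_err => /= g_x dot_x dot_err; lra.
Qed.

End HilbertSpace.

(* Krein-Lax extrapolation: iterating the quadratic inequality gives
   [(beta 1 / beta 0) ^ (2 ^ k) <= beta (2 ^ k) / beta 0], and a power that grows
   at most like [M ^ (2 ^ k)] has base at most [M]. *)
Lemma doubling_ratio {R : realType} (beta : nat -> R) (K M : R) : 0 < M ->
  (forall n, 0 <= beta n) ->
  (forall n, beta n ^+ 2 <= beta (n + n)%N * beta 0%N) ->
  (forall n, beta n <= K * M ^+ n) ->
  beta 1%N <= M * beta 0%N.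
Proof.
move=> M_gt0 beta_ge0 beta2 betaK; rewrite leNgt; apply/negP => beta1_gt.
have [b0|b0_neq0] := eqVneq (beta 0%N) 0.
  have b1_gt0 : 0 < beta 1%N by apply: le_lt_trans beta1_gt; rewrite b0 mulr0.
  have := beta2 1%N; rewrite b0 mulr0 leNgt => /negP; apply.
  by rewrite exprn_gt0.
have b0_gt0 : 0 < beta 0%N by rewrite lt_def b0_neq0 beta_ge0.
pose rho := beta 1%N / beta 0%N.
have rho_ge0 : 0 <= rho by rewrite divr_ge0.
have pow k : rho ^+ (2 ^ k) * beta 0%N <= beta (2 ^ k)%N.
  elim: k => [|k IHk]; first by rewrite expn0 expr1 divfK.
  rewrite expnS mul2n -addnn exprD -(ler_pM2r b0_gt0).
  apply: le_trans (beta2 _); rewrite [leRHS]expr2 -[X in X <= _]mulrA mulrACA.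
  by rewrite ler_pM// mulr_ge0// exprn_ge0.
pose h := rho / M - 1.
have h_gt0 : 0 < h by rewrite subr_gt0 ltr_pdivlMr// mul1r ltr_pdivlMr.
have [n n_gt] : exists n, K / beta 0%N / h < n%:R.
  by exists (Num.truncn (K / beta 0%N / h)).+1; exact: truncnS_gt.
(* Bernoulli: [(1 + h) ^+ (2 ^ n) >= 1 + 2 ^ n * h >= n * h], where [1 + h = rho / M]. *)
have : n%:R * h <= K / beta 0%N.
  apply: le_trans (_ : (rho / M) ^+ (2 ^ n) <= _).
    have := ler_1DMn_expr (2 ^ n) (ltW h_gt0); rewrite [1 + h]addrC subrK.
    apply: le_trans; apply: le_trans (_ : (2 ^ n)%:R * h <= _).
      by apply: ler_wpM2r; [exact: ltW | rewrite ler_nat; exact/ltnW/ltn_expl].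
    by rewrite lerDr.
  rewrite expr_div_n ler_pdivrMr ?exprn_gt0// mulrAC ler_pdivlMr//.
  exact: le_trans (pow n) _.
by rewrite leNgt -ltr_pdivrMr// n_gt.
Qed.

(** * Operators with an A-adjoint are bounded for the A-seminorm *)

Section AdjointableBounded.
Context {R : realType} {H : completeNormedModType R[i]}.
Variables (dot : {inner H}) (A T Ts : {linear H -> H}).
Hypothesis Hdot : norm_induced_by dot.
Hypothesis A_sym : is_adjoint dot A A.
Hypothesis A_ge0 : forall x, 0 <= dot (A x) x.
Hypothesis Ts_bounded : bounded_op Ts.
Hypothesis Ts_adj : is_adjoint dot T Ts.
Hypothesis Ts_range : (range (Ts \o A) `<=` range A)%classic.

Let liftE z : exists z', A z' = Ts (A z).
Proof. by have [|z' _ <-] := Ts_range (Ts (A z)); [exists z | exists z']. Qed.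

Lemma rnorm_AT_le : exists2 C : R, 0 < C &
  forall x, rnorm (A (T x)) <= C * rnorm (A x).
Proof.
have dotAT x z z' : A z' = Ts (A z) -> dot (A (T x)) z = dot (A x) z'.
  by move=> z'E; rewrite A_sym Ts_adj -z'E -A_sym.
pose S := [set A (T x) | x in [set x | rnorm (A x) <= 1]]%classic.
have [|C CP] := uniform_boundedness _ Hdot S.
  move=> z; have [z' z'E] := liftE z; exists (rnorm z') => _ [x /= x1 <-].
  rewrite (dotAT _ _ _ z'E) (le_trans (CauchySchwarz_rnorm _ Hdot _ _))//.
  by rewrite ler_piMl ?rnorm_ge0.
exists (`|C| + 1) => [|x]; first by rewrite ltr_wpDl.
have [Ax0|Ax_neq0] := eqVneq (rnorm (A x)) 0.
  (* Here [A x = 0]. Pairing [A (T x)] with itself gives [dot (A x) z' = 0], so [A (T x) = 0]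
     too. *)
  have [z' z'E] := liftE (A (T x)).
  have := dotAT x _ _ z'E; rewrite (rnorm0_eq0 _ Ax0) linear0l => /eqP.
  rewrite dnorm_eq0 => /eqP ->.
  by rewrite /rnorm !normr0 mulr0.
have Ax_gt0 : 0 < rnorm (A x) by rewrite lt_def Ax_neq0 rnorm_ge0.
pose c : R := (rnorm (A x))^-1.
have c_gt0 : 0 < c by rewrite invr_gt0.
have := CP (A (T (c%:C *: x))).
rewrite !linearZ/= rnormZ (normc_nng _ (ltW c_gt0)) => cP.
have {}cP : c * rnorm (A (T x)) <= C.
  apply: cP; exists (c%:C *: x); rewrite /= !linearZ//=.
  by rewrite rnormZ (normc_nng _ (ltW c_gt0)) mulVf.
rewrite -ler_pdivrMr// mulrC (le_trans cP)//.
by rewrite (le_trans (ler_norm _))// lerDl.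
Qed.

(** A chosen [f] with [A (f x) = Ts (A (T x))] acts as the A-adjoint of [T] composed with [T].
    Krein-Lax applies to the moments of its iterates: the crude growth bound contains [rnorm x], but
    only in the prefactor that extrapolation removes. *)
Lemma normA_T_le : exists2 M : R, 0 < M &
  forall x, normA dot A (T x) ^+ 2 <= M * normA dot A x ^+ 2.
Proof.
have [C C_gt0 CP] := rnorm_AT_le.
have [N N_gt0 NP] := bounded_op_rnorm _ Ts_bounded.
have [f fP] := choice (fun z => liftE (T z)).
(* Both sides equal [dotA dot A (T y) (T z)]; linearity of [f] does not enter. *)
have dotA_f y z : dotA dot A (f y) z = dotA dot A y (f z).
  by rewrite /dotA fP dotC -Ts_adj -dotC !A_sym fP -Ts_adj.
have dotA_f1 x : dotA dot A (f x) x = (normA dot A (T x) ^+ 2)%:C.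
  by rewrite dotA_f /dotA A_sym fP -Ts_adj -A_sym -(dotAxx _ _ A_ge0).
have dotA_iter m n x y :
    dotA dot A (iter m f x) (iter n f y) = dotA dot A (iter (m + n) f x) y.
  by elim: n m => [|n IHn] m; [rewrite addn0 | rewrite /= -dotA_f -iterS IHn addSnnS].
(* Each application of [f] costs a factor [C] for [T] under [A] and a factor [N] for [Ts]. *)
have A_iter n x : rnorm (A (iter n f x)) <= rnorm (A x) * (N * C) ^+ n.
  elim: n => [|n IHn]; first by rewrite mulr1.
  rewrite iterS fP exprSr mulrA (le_trans (NP _))//.
  by rewrite -[leRHS]mulrC -mulrA ler_pM2l// (le_trans (CP _))// ler_pM2l.
exists (N * C) => [|x]; first by rewrite mulr_gt0.
pose beta n := normc (dotA dot A (iter n f x) x).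
have beta0 : beta 0%N = normA dot A x ^+ 2.
  by rewrite /beta/= dotAxx// normc_nng ?sqr_ge0.
have beta1 : beta 1%N = normA dot A (T x) ^+ 2.
  by rewrite /beta/= dotA_f1 normc_nng ?sqr_ge0.
rewrite -beta0 -beta1.
apply: (@doubling_ratio _ _ (rnorm (A x) * rnorm x)) => [|n|n|n].
- by rewrite mulr_gt0.
- exact: normc_ge0.
- rewrite beta0 (_ : beta (n + n)%N = normA dot A (iter n f x) ^+ 2); last first.
    by rewrite /beta -dotA_iter dotAxx// normc_nng ?sqr_ge0.
  rewrite -exprMn ler_pXn2r ?nnegrE ?mulr_ge0 ?normA_ge0 ?normc_ge0//.
  exact: CauchySchwarzA.
- rewrite (le_trans (CauchySchwarz_rnorm _ Hdot _ _))// mulrAC.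
  by rewrite ler_wpM2r ?rnorm_ge0.
Qed.

End AdjointableBounded.

(** * Phase alignment and the bound on one product *)

(** A square root of [Num.conj a / |a|] serves as [c]. In the test vector, [a] is multiplied by [c]
    and the other term by [Num.conj c]; this makes both nonnegative multiples of [Num.conj c]. *)
Lemma unit_phase {R : realType} (a : R[i]) :
  exists2 c : R[i], normc c = 1 & c * a = Num.conj c * (normc a)%:C.
Proof.
have [->|a_neq0] := eqVneq a 0.
  exists 1; first by rewrite (normc_nng 1).
  by rewrite (normc_nng 0)// !mulr0.
have na_neq0 : `|a| != 0 by rewrite normr_eq0.
pose c := sqrtC (Num.conj a / `|a|).
have c2 : c ^+ 2 = Num.conj a / `|a| by rewrite sqrtCK.
have c_norm : `|c| = 1.
  apply/eqP; rewrite -(@eqrXn2 _ 2)// expr1n -normrX c2 normrM normfV.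
  by rewrite norm_conjC normr_id divff.
exists c; first by apply: (@complexI R).
have cc : c * Num.conj c = 1 by rewrite -normCK c_norm expr1n.
have -> : c * a = Num.conj c * (c ^+ 2 * a).
  by rewrite expr2 !mulrA [Num.conj c * c]mulrC cc mul1r.
by rewrite c2 mulrAC [Num.conj a * a]mulrC -normCK expr2 mulfK.
Qed.

Section PhaseRotation.
Context {R : realType} {V : lmodType R[i]}.
Variables (dot : {inner V}) (A S T : {linear V -> V}) (w : R).
Hypothesis A_sym : forall x y, dot (A x) y = dot x (A y).
Hypothesis A_ge0 : forall x, 0 <= dot (A x) x.
Hypothesis S_null : forall y, normA dot A y = 0 -> normA dot A (S y) = 0.
Hypothesis w_bound : forall x y, normA dot A x ^+ 2 + normA dot A y ^+ 2 = 1 ->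
  normc (dotA dot A (S y) x + dotA dot A (T x) y) <= w.

Lemma normc_dotA_comp_le x : normA dot A x = 1 ->
  normc (dotA dot A (S (T x)) x) <= w ^+ 2.
Proof.
move=> x1; set a := dotA dot A (S (T x)) x; set s := normA dot A (T x).
(* A null [T x] cannot be normalised, but then [S (T x)] is null and [a] vanishes. *)
have [s0|s_neq0] := eqVneq s 0.
  apply: le_trans (CauchySchwarzA _ _ A_sym A_ge0 _ _) _.
  by rewrite S_null// mul0r sqr_ge0.
have s_gt0 : 0 < s by rewrite lt_def s_neq0 normA_ge0.
have [c c1 ca] := unit_phase a.
pose r : R := Num.sqrt 2^-1.
have r_ge0 : 0 <= r by rewrite sqrtr_ge0.
have r2 : r ^+ 2 = 2^-1 by rewrite sqr_sqrtr.
(* Each component of the test vector gets squared seminorm 1/2. *)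
pose k := (r / s)%:C * c.
have k_norm : normc k = r / s.
  by rewrite normcM c1 mulr1 normc_nng// divr_ge0// ltW.
have k_conj : Num.conj k = (r / s)%:C * Num.conj c.
  by rewrite rmorphM; congr (_ * _); exact: conj_real.
have := w_bound (r%:C *: x) (k *: T x).
rewrite !normAZ// x1 mulr1 normc_nng// k_norm divfK// r2 => /(_ _)/wrap[].
  by lra.
have -> : dotA dot A (S (k *: T x)) (r%:C *: x) +
    dotA dot A (T (r%:C *: x)) (k *: T x) =
    Num.conj c * (r ^+ 2 / s * (normc a + s ^+ 2))%:C.
  rewrite !linearZ/= !dotAZl !dotAZr -/a k_conj conj_real dotAxx// -/s.
  rewrite !(rmorphXn, rmorphD, rmorphM)/=.
  transitivity (r%:C ^+ 2 * (s^-1)%:C * (c * a + Num.conj c * s%:C ^+ 2)).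
    by rewrite /k rmorphM /=; ring.
  by rewrite ca; ring.
rewrite normcM normc_conj c1 mul1r r2 normc_nng; last first.
  by rewrite mulr_ge0 ?divr_ge0 ?addr_ge0 ?normc_ge0 ?sqr_ge0 ?ltW.
rewrite mulrAC ler_pdivrMr// => le_ws.
have := sqr_ge0 (w - s); lra.
Qed.

End PhaseRotation.

(** * Passage to the direct sum and conclusion *)

Theorem theorem3p3 (R : realType) (H : completeNormedModType R[i])
    (dot : {inner H}) (Hdot : norm_induced_by dot)
    (A : {linear H -> H}) (HA : positive_op dot A)
    (T2 T3 : {linear H -> H}) (HT2 : in_LA dot A T2) (HT3 : in_LA dot A T3) :
  wA (dsum_dot dot) (block_op A \0 \0 A) (block_op \0 T2 T3 \0) ^+ 2 >=
  1 / 2 * Num.max (wA dot A ((T2 \o T3) \+ (T3 \o T2)))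
                  (wA dot A ((T2 \o T3) \- (T3 \o T2))).
Proof.
have [_ A_sym A_ge0] := HA.
have normA_le T : in_LA dot A T -> exists2 M : R, 0 < M &
    forall x, normA dot A (T x) ^+ 2 <= M * normA dot A x ^+ 2.
  by move=> [_ [Ts [Ts_bounded Ts_adj Ts_range]]]; exact: normA_T_le Ts_range.
have [M2 M2_gt0 T2_le] := normA_le _ HT2.
have [M3 M3_gt0 T3_le] := normA_le _ HT3.
have null (T : H -> H) (M : R) :
    (forall x, normA dot A (T x) ^+ 2 <= M * normA dot A x ^+ 2) ->
    forall y, normA dot A y = 0 -> normA dot A (T y) = 0.
  move=> T_le y y0; apply/eqP; rewrite -sqrf_eq0 eq_le sqr_ge0 andbT.
  by rewrite (le_trans (T_le _))// y0 expr0n mulr0.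
set w := wA (dsum_dot dot) _ _.
have dotA_dsum u v : dotA (dsum_dot dot) (block_op A \0 \0 A) u v =
    dotA dot A u.1 v.1 + dotA dot A u.2 v.2.
  by rewrite /dotA /block_op /= addr0 add0r.
have normA_dsum u : normA (dsum_dot dot) (block_op A \0 \0 A) u =
    Num.sqrt (normA dot A u.1 ^+ 2 + normA dot A u.2 ^+ 2).
  by rewrite {1}/normA dotA_dsum !dotAxx.
have dotA_block u : dotA (dsum_dot dot) (block_op A \0 \0 A)
    (block_op \0 T2 T3 \0 u) u = dotA dot A (T2 u.2) u.1 + dotA dot A (T3 u.1) u.2.
  by rewrite dotA_dsum /= add0r addr0.
have w_bound x y : normA dot A x ^+ 2 + normA dot A y ^+ 2 = 1 ->
    normc (dotA dot A (T2 y) x + dotA dot A (T3 x) y) <= w.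
  move=> xy1; apply: ub_le_sup.
    (* By Cauchy-Schwarz and [2 a b <= a^2 + b^2], each term is at most half the sum of the two
       squared seminorms; this yields even half of the stated bound. *)
    exists (M2 + M3 + 1) => _ [u u1 <-]; rewrite dotA_block.
    move: u1 => /=; rewrite normA_dsum; case: u => x' y' /= /(congr1 (fun t => t ^+ 2)).
    rewrite expr1n sqr_sqrtr ?addr_ge0 ?sqr_ge0// => xy1'.
    apply: le_trans (normcD _ _) _.
    have := CauchySchwarzA _ _ A_sym A_ge0 (T2 y') x'.
    have := CauchySchwarzA _ _ A_sym A_ge0 (T3 x') y'.
    have := T2_le y'; have := T3_le x'.
    have := sqr_ge0 (normA dot A x'); have := sqr_ge0 (normA dot A y').
    have := sqr_ge0 (normA dot A (T2 y') - normA dot A x').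
    have := sqr_ge0 (normA dot A (T3 x') - normA dot A y').
    move: xy1'; nra.
  exists (x, y); first by rewrite /= normA_dsum/= xy1 sqrtr1.
  by rewrite dotA_block.
have T2T3_le := normc_dotA_comp_le _ _ _ _ _ A_sym A_ge0 (null _ _ T2_le) w_bound.
(* Swapping the two components of the vector exchanges [T2] and [T3] in [w_bound]. *)
have T3T2_le : forall x, normA dot A x = 1 ->
    normc (dotA dot A (T3 (T2 x)) x) <= w ^+ 2.
  apply: normc_dotA_comp_le => //; first exact: null T3_le.
  by move=> x y xy1; rewrite addrC w_bound// addrC.
have wA_le (F : H -> H) : (forall x, normA dot A x = 1 ->
    normc (dotA dot A (F x) x) <= 2 * w ^+ 2) -> wA dot A F <= 2 * w ^+ 2.
  (* Without vectors of seminorm 1, [sup] takes its default value 0. *)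
  move=> F_le; have [E0|E_neq0] := eqVneq
    [set normc (dotA dot A (F x) x) | x in [set x | normA dot A x = 1]]%classic set0.
    by rewrite /wA E0 sup0 mulr_ge0 ?sqr_ge0.
  apply: ge_sup; first exact/set0P.
  by move=> _ [x x1 <-]; exact: F_le.
rewrite mul1r mulrC ler_pdivrMr// mulrC ge_max !wA_le// => x x1 /=.
- rewrite {1}/dotA linearB linearBl (le_trans (normcB _ _))//.
  by have := T2T3_le _ x1; have := T3T2_le _ x1; lra.
- rewrite {1}/dotA linearD linearDl (le_trans (normcD _ _))//.
  by have := T2T3_le _ x1; have := T3T2_le _ x1; lra.
Qed.
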